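(* For every positive integer $n$ and every $J\subseteq[n-2]$, \[\sum_{\pi\in C_nD_{n-1,J}^{-1}}\mathbf{x}^{\mathrm{cDes}(\pi)}t^{\pi^{-1}(n)}=\sum_{\pi\in D_{n-1,J}^{-1}C_n}\mathbf{x}^{\mathrm{cDes}(\pi)}t^{\pi^{-1}(n)}.\]
   Context: Permutations are written in one-line notation and composed right to left, $(\sigma\tau)(i)=\sigma(\tau(i))$. For $\pi\in\mathfrak{S}_n$, $\mathrm{Des}(\pi)=\{i\in[n-1]:\pi(i)>\pi(i+1)\}$ and $\mathrm{cDes}(\pi)=\{i\in[n]:\pi(i)>\pi(i+1)\}$ with the convention $\pi(n+1):=\pi(1)$. For $J\subseteq[n]$, $\mathbf{x}^J=\prod_{i\in J}x_i$; $t$ is an additional variable. Let $c_n=(1,2,\dots,n)=23\cdots n1$ and $C_n=\langle c_n\rangle$. $D_{n-1,J}=\{\pi\in\mathfrak{S}_{n-1}:\mathrm{Des}(\pi)=J\}$, $D_{n-1,J}^{-1}=\{\pi^{-1}:\pi\in D_{n-1,J}\}$, viewed as a subset of $\mathfrak{S}_n$ by identifying $\mathfrak{S}_{n-1}$ with the permutations of $\mathfrak{S}_n$ fixing $n$. For $A\subseteq\mathfrak{S}_n$, $C_nA=\{c\sigma: c\in C_n,\sigma\in A\}$ and $AC_n=\{\sigma c:\sigma\in A,c\in C_n\}$. *)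

(* Defs.v *)
From mathcomp Require Export all_boot all_order all_algebra all_fingroup.
From mathcomp Require Export mpoly.
Set Implicit Arguments. Unset Strict Implicit. Unset Printing Implicit Defensive.
Import GRing.Theory.

(* Conventions: the paper's [k] = {1..k} is encoded by 'I_k = {0..k-1},
   position/value i (1-based) <-> ordinal i-1.  Permutations are {perm 'I_k}.
   MathComp's product on perms is left-to-right: (s * t)%g x = t (s x).
   The paper composes right to left: (sigma tau)(i) = sigma(tau(i)),
   so the paper's product sigma tau is pmul sigma tau := (tau * sigma)%g. *)

Definition pmul k (s t : {perm 'I_k}) : {perm 'I_k} := (t * s)%g.

Definition Des k (s : {perm 'I_k}) : {set 'I_k} :=
  [set i : 'I_k | [exists j : 'I_k, (val j == i.+1) && (s j < s i)%N]].

Definition cDes k (s : {perm 'I_k}) : {set 'I_k} :=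
  [set i : 'I_k | (s (ordS i) < s i)%N].

Definition cyc k : {perm 'I_k} := perm (@ordS_inj k).

Definition Cn k : {set {perm 'I_k}} := <[cyc k]>%g.

Definition embed m (s : {perm 'I_m}) : {perm 'I_m.+1} := lift_perm ord_max ord_max s.

Definition DinvJ m (J : {set 'I_m}) : {set {perm 'I_m.+1}} :=
  [set embed (s^-1)%g | s in [set s : {perm 'I_m} | Des s == J]].

Definition CnA k (A : {set {perm 'I_k}}) : {set {perm 'I_k}} :=
  [set pmul c s | c in Cn k, s in A].
Definition ACn k (A : {set {perm 'I_k}}) : {set {perm 'I_k}} :=
  [set pmul s c | s in A, c in Cn k].

(* For n = m+1: polynomial ring Z[x_1,...,x_n,t], with variable (widen i)
   standing for x_{i+1} (i : 'I_n) and variable ord_max standing for t. *)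
Definition weight m (p : {perm 'I_m.+1}) : {mpoly int[m.+2]} :=
  (\prod_(i in cDes p) 'X_(widen_ord (leqnSn m.+1) i))
  * 'X_(ord_max) ^+ (val ((p^-1)%g ord_max)).+1.

(* Main.v *)
Require Import Defs.
From mathcomp Require Import zify.
Import GRing.Theory.
Set Implicit Arguments.
Unset Strict Implicit.
Unset Printing Implicit Defensive.

(* Fix the position k of the largest value, so that the cyclic descent set becomes the
   descent set of the word read cyclically after position k. On both sides the permutations
   are then indexed by the s with Des s = J: on the right the word is s^-1, on the left it
   is the word of s^-1 rotated in positions and in values around the point (k, s^-1 k).
   By inclusion-exclusion, for J and for the descent set, it is enough to count the s with
   Des s contained in J whose word has descent set contained in a given S. Replacing values
   by their J-blocks turns such s into words of fixed content that are sorted on each row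
   (S-block of positions): increasingly on the right; on the left for the cyclic order of
   the letters starting at the letter b in the distinguished position q, the other copies
   of b being smallest before q and largest after q. Both kinds of words are determined by
   the matrix counting the occurrences of each letter in each row, and every matrix occurs:
   if q is the o-th position of its row, then b must be the o-th largest letter there. *)

(** * Counting by subsets of a set-valued statistic *)

Section InclusionExclusion.
Variables (T1 T2 I : finType).

Lemma card_fiber_subset (T : finType) (P : pred T) (D : T -> {set I}) (S : {set I}) :
  #|[set x | P x & D x \subset S]|
  = \sum_(U : {set I} | U \subset S) #|[set x | P x & D x == U]|.
Proof.
rewrite -sum1_card (partition_big D (fun U => U \subset S)) /=; last first.
  by move=> x; rewrite inE => /andP[].
apply: eq_bigr => U sUS; rewrite -sum1_card; apply: eq_bigl => x.
by rewrite !inE -andbA; case: eqP => [->|]; rewrite ?sUS ?andbF ?andbT.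
Qed.

Lemma eq_card_fiber (P1 : pred T1) (P2 : pred T2)
    (D1 : T1 -> {set I}) (D2 : T2 -> {set I}) :
  (forall S : {set I}, #|[set x | P1 x & D1 x \subset S]|
           = #|[set x | P2 x & D2 x \subset S]|) ->
  forall S : {set I}, #|[set x | P1 x & D1 x == S]| = #|[set x | P2 x & D2 x == S]|.
Proof.
move=> eqD S; have [n leSn] := ubnP #|S|.
elim: n => // n IHn in S leSn *.
have := eqD S; rewrite !card_fiber_subset (bigD1 S) //= [RHS](bigD1 S) //=.
have -> : \sum_(U : {set I} | (U \subset S) && (U != S)) #|[set x | P1 x & D1 x == U]|
  = \sum_(U : {set I} | (U \subset S) && (U != S)) #|[set x | P2 x & D2 x == U]|.
  apply: eq_bigr => U /andP[sUS neUS]; apply: IHn; rewrite -ltnS; apply: leq_trans leSn.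
  by rewrite ltnS; apply: proper_card; rewrite properEneq neUS.
by move/addIn.
Qed.

End InclusionExclusion.

(** * Blocks cut out by a set of positions *)

Section Blocks.
Variable m : nat.

(** The fibres are the intervals obtained by cutting after each element of [J], numbered from the
    left. *)
Definition block (J : {set 'I_m}) (x : 'I_m) : 'I_m.+1 := inord #|[set j in J | j < x]|.

Definition desf (u : 'I_m -> nat) : {set 'I_m} :=
  [set i : 'I_m | [exists j : 'I_m, (val j == i.+1) && (u j < u i)]].

Lemma val_perm_inj (s : {perm 'I_m}) : injective (fun i => val (s i)).
Proof. by move=> x y /val_inj/perm_inj. Qed.

Lemma val_block J x : block J x = #|[set j in J | j < x]| :> nat.
Proof.
by rewrite inordK // ltnS -[leqRHS]card_ord; exact: max_card.
Qed.

Lemma block_le J (x y : 'I_m) : x <= y -> block J x <= block J y.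
Proof.
move=> lexy; rewrite !val_block; apply: subset_leq_card; apply/subsetP => j.
by rewrite !inE => /andP[-> /leq_trans]; apply.
Qed.

Lemma block_lt J (x y : 'I_m) : block J x < block J y -> x < y.
Proof. by case: (ltnP x y) => // /(block_le J); rewrite leqNgt => /negPf->. Qed.

Lemma block_between J (x y z : 'I_m) :
  x <= y -> y <= z -> block J x = block J z -> block J y = block J x.
Proof.
move=> /(block_le J) xy /(block_le J) yz e; apply/val_inj/eqP.
by rewrite /= eqn_leq xy andbT e yz.
Qed.

Lemma block_succ J (x y : 'I_m) : val y = x.+1 -> (block J x == block J y) = (x \notin J).
Proof.
move=> yE; rewrite -val_eqE /= !val_block.
have -> : [set j in J | j < y] = (if x \in J then [set x] else set0) :|: [set j in J | j < x].
  apply/setP => j; rewrite !inE; change (nat_of_ord y) with (val y).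
  rewrite yE ltnS leq_eqVlt (val_eqE j x).
  case: (eqVneq j x) => [->|ne]; case xJ: (x \in J); rewrite !inE ?xJ ?eqxx //=.
  by rewrite (negPf ne).
case xJ: (x \in J); last by rewrite set0U eqxx.
by rewrite cardsU1 inE ltnn andbF /= add1n; apply/negbTE; lia.
Qed.

(** Injectivity turns a non-descent into a strict ascent, and these chain along a block. *)
Lemma desf_subP (J : {set 'I_m}) (u : 'I_m -> nat) : injective u ->
  reflect (forall x y : 'I_m, x < y -> block J x = block J y -> u x < u y)
          (desf u \subset J).
Proof.
move=> uI; apply: (iffP subsetP) => [sub x y|inc x].
  have [n] := ubnP (y - x); elim: n => // n IHn in x y *.
  move=> len xy exy; have x1m : x.+1 < m by apply: leq_ltn_trans (ltn_ord y).
  pose x' := Ordinal x1m.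
  have ex : block J x' = block J x by apply: (@block_between _ _ _ y) => //=.
  have lx : u x < u x'.
    have : x \notin J by rewrite -(@block_succ J x x' erefl) ex.
    apply: contraR; rewrite -leqNgt => le; apply: sub; rewrite inE.
    apply/existsP; exists x'; rewrite eqxx /= ltn_neqAle le andbT.
    by apply/eqP => /uI/(congr1 val) /=; lia.
  case: (ltngtP x' y) => [lt|/= gt|/val_inj <- //]; last by lia.
  by apply: ltn_trans lx _; apply: IHn => //=; [lia|rewrite ex].
rewrite inE => /existsP[y /andP[/eqP yE lt]]; apply: contraLR lt.
rewrite -(block_succ J yE) => /eqP e; rewrite -leqNgt ltnW // inc //.
by change (val x < val y); rewrite yE.
Qed.

End Blocks.

(** * Words of fixed content and their matrices *)

Section Words.
Variable m : nat.

(* Rearrangement inequality: a maximiser of [\sum_l l * K l (f l)] admits no improving swap. *)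
Lemma exists_swap_sorted (T : finType) (C : pred {ffun 'I_m -> T})
    (K : 'I_m -> T -> nat) f0 : C f0 ->
  exists2 f, C f & forall i j : 'I_m, i < j ->
    C [ffun l => f (tperm i j l)] ->
    K i (f j) = K j (f j) -> K j (f i) = K i (f i) -> K i (f i) <= K j (f j).
Proof.
move=> C0; case: (arg_maxnP (fun f : {ffun 'I_m -> T} => \sum_(l < m) l * K l (f l)) C0).
move=> f Cf fmax; exists f => // i j ij Cs e1 e2.
have := fmax _ Cs; have neij : j != i by rewrite -val_eqE /=; lia.
have split2 F : \sum_(l < m) F l = F i + (F j + \sum_(l < m | (l != i) && (l != j)) F l).
  by rewrite (bigD1 i) //= (bigD1 j).
rewrite !split2 !ffunE tpermL tpermR.
set S1 := \sum_(_ < m | _) _; set S2 := \sum_(_ < m | _) _.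
have -> : S1 = S2.
  by apply: eq_bigr => l /andP[li lj]; rewrite ffunE tpermD // eq_sym.
(* The swap changes the sum by [(j - i) * (K i (f i) - K j (f j))], positive under [lt]. *)
rewrite e1 e2 => le; rewrite leqNgt; apply/negP => lt; nia.
Qed.

Lemma first_difference (T : eqType) (f g : 'I_m -> T) :
  (forall i : 'I_m, (forall j : 'I_m, j < i -> f j = g j) -> f i = g i) -> f =1 g.
Proof.
move=> H i; have [n] := ubnP i; elim: n => // n IHn in i *.
by move=> lein; apply: H => j ltj; apply: IHn; apply: leq_trans ltj _; rewrite -ltnS.
Qed.

(** [inord] loses nothing: each count is at most [m]. *)
Definition matrix_of (R : finType) (A : 'I_m -> R) (f : {ffun 'I_m -> 'I_m.+1}) :
    {ffun R * 'I_m.+1 -> 'I_m.+1} :=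
  [ffun tc => inord #|[set i | (A i == tc.1) && (f i == tc.2)]|].

Lemma matrix_of_eq (R : finType) (A : 'I_m -> R) f g : matrix_of A f = matrix_of A g ->
  forall t (P : pred 'I_m.+1),
  #|[set i | (A i == t) && P (f i)]| = #|[set i | (A i == t) && P (g i)]|.
Proof.
move=> /ffunP e t P.
have row (h : {ffun 'I_m -> 'I_m.+1}) :
  #|[set i | (A i == t) && P (h i)]| = \sum_(c | P c) matrix_of A h (t, c).
  rewrite -sum1_card (partition_big h P) /=; last by move=> i; rewrite inE => /andP[].
  apply: eq_bigr => c Pc; rewrite ffunE inordK; last first.
    by rewrite ltnS -[leqRHS]card_ord; exact: max_card.
  rewrite -sum1_card; apply: eq_bigl => i.
  by rewrite !inE -andbA; case: eqP => //= _; case: eqP => [->|]; rewrite ?Pc ?andbF.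
by rewrite !row; apply: eq_bigr => c _; rewrite e.
Qed.

(** Otherwise the row positions with [P (f j)] form a proper subset of those with [P (g j)], missing
    [i], against equal counts. *)
Lemma matrix_of_row_strict (R : finType) (A : 'I_m -> R) f g i (P : pred 'I_m.+1) :
  matrix_of A f = matrix_of A g ->
  (forall j, A j = A i -> P (f j) -> P (g j)) -> P (g i) -> P (f i).
Proof.
move=> /matrix_of_eq/(_ (A i) P) e sub Pg; apply: contraT => nPf.
suff : #|[set j | (A j == A i) && P (f j)]| < #|[set j | (A j == A i) && P (g j)]|.
  by rewrite e ltnn.
apply: proper_card; apply/properP; split.
  by apply/subsetP => j; rewrite !inE => /andP[/eqP Aj Pj]; rewrite Aj eqxx sub.
by exists i; rewrite !inE eqxx.
Qed.

Lemma matrix_of_tperm (R : finType) (A : 'I_m -> R) (f : {ffun 'I_m -> 'I_m.+1}) i j : A i = A j ->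
  matrix_of A [ffun l => f (tperm i j l)] = matrix_of A f.
Proof.
move=> e; apply/ffunP => -[t c]; rewrite !ffunE /=; congr inord.
rewrite -[RHS](card_imset _ (@perm_inj _ (tperm i j))); apply: eq_card => l.
rewrite -{2}(tpermK i j l) mem_imset ?inE ?ffunE; last exact: perm_inj.
suff -> : A (tperm i j l) = A l by [].
by case: tpermP => // ->.
Qed.

Variables J S : {set 'I_m}.
Let B := block J.
Let A := block S.

Definition words : {set {ffun 'I_m -> 'I_m.+1}} :=
  [set [ffun i => B (v i)] | v : {perm 'I_m}].

Lemma words_tperm (f : {ffun 'I_m -> 'I_m.+1}) i j :
  f \in words -> [ffun l => f (tperm i j l)] \in words.
Proof.
case/imsetP => v _ ->; apply/imsetP; exists (tperm i j * v)%g => //.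
by apply/ffunP => l; rewrite !ffunE permM.
Qed.

(** * Standardization: permutations with descents in [J] as words *)

Section Standardization.
Variable tau : {perm 'I_m}.

Definition word_of (s : {perm 'I_m}) : {ffun 'I_m -> 'I_m.+1} :=
  [ffun i => B (s^-1%g (tau i))].

(** At a first difference [z x < z' x], [z'] takes the value [z x] at some [y] in the block of [x]:
    [y < x] contradicts agreement before [x], and [x < y] contradicts monotonicity on the block. *)
Lemma word_of_inj : {in [set s | Des s \subset J] &, injective word_of}.
Proof.
move=> s s'; rewrite !inE.
move=> /(desf_subP _ (@val_perm_inj _ s)) Hs /(desf_subP _ (@val_perm_inj _ s')) Hs' /ffunP e.
have {}e y : B (s^-1 y)%g = B (s'^-1 y)%g.
  by have := e (tau^-1 y)%g; rewrite !ffunE permKV.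
suff aux (z z' : {perm 'I_m}) (x : 'I_m) : (forall y, B (z^-1 y)%g = B (z'^-1 y)%g) ->
    (forall x y : 'I_m, x < y -> block J x = block J y -> z' x < z' y) ->
    (forall y : 'I_m, y < x -> z y = z' y) -> z x < z' x -> false.
  apply/permP; apply: first_difference => x IH; apply: val_inj.
  case: (ltngtP (s x) (s' x)) => // lt.
    by have := aux s s' x e Hs' IH lt.
  by have := aux s' s x (fun y => esym (e y)) Hs (fun y h => esym (IH y h)) lt.
move=> {}e H IH lt; set y := (z'^-1 (z x))%g.
have zy : z' y = z x by rewrite permKV.
have ey : B x = B y by rewrite /y -e permK.
case: (ltngtP y x) => [yx|xy|/val_inj yx].
- by have := IH _ yx; rewrite zy => /perm_inj yx'; move: yx; rewrite yx' ltnn.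
- by have := H _ _ xy ey; rewrite zy; lia.
- by move: lt; rewrite -zy yx ltnn.
Qed.

(** Exchanging the values of [s] at two positions of one block keeps the word, so some permutation
    with the given word increases on each block. *)
Lemma word_of_onto : word_of @: [set s | Des s \subset J] = words.
Proof.
apply/setP => f; apply/imsetP/imsetP => [[s _ ->]|[v _ ->]].
  by exists (tau * s^-1)%g => //; apply/ffunP => i; rewrite !ffunE permM.
pose C (z : {ffun 'I_m -> 'I_m}) :=
  [exists s : {perm 'I_m}, (z == [ffun x => s x]) && (word_of s == [ffun i => B (v i)])].
have C0 : C [ffun x => (v^-1 * tau)%g x].
  apply/existsP; exists (v^-1 * tau)%g; rewrite eqxx /=; apply/eqP/ffunP => i.
  by rewrite !ffunE invMg invgK permM permK.
case: (exists_swap_sorted (fun _ y => val y) C0) => z /existsP[s /andP[/eqP -> /eqP ws]] Hz.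
exists s; rewrite ?ws // inE.
apply/(desf_subP _ (@val_perm_inj _ s)) => x y xy exy.
have := Hz x y xy; rewrite !ffunE ltn_neqAle => Hxy; apply/andP; split.
  by apply/eqP => /val_inj/perm_inj e; move: xy; rewrite e ltnn.
apply: Hxy => //; apply/existsP; exists (tperm x y * s)%g.
apply/andP; split; first by apply/eqP/ffunP => l; rewrite !ffunE permM.
apply/eqP/ffunP => i; have /ffunP/(_ i) := ws; rewrite !ffunE => <-.
rewrite invMg tpermV permM; case: tpermP => // ->; exact: esym.
Qed.

Lemma card_word_of (P : pred {ffun 'I_m -> 'I_m.+1}) :
  #|[set s | (Des s \subset J) && P (word_of s)]| = #|[set f in words | P f]|.
Proof.
rewrite -[LHS](card_in_imset (f := word_of)); last first.
  by move=> s s'; rewrite !inE => /andP[h _] /andP[h' _]; apply: word_of_inj; rewrite inE.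
apply: eq_card => f; rewrite inE -word_of_onto; apply/imsetP/andP.
  by case=> s; rewrite inE => /andP[h p] ->; rewrite p imset_f ?inE.
by case=> /imsetP[s h ->] p; exists s => //; move: h; rewrite !inE p andbT.
Qed.

End Standardization.

(** * Words increasing along each row *)

Definition row_sorted (f : {ffun 'I_m -> 'I_m.+1}) :=
  [forall i : 'I_m, forall j : 'I_m, (i < j) && (A i == A j) ==> (f i <= f j)].

Lemma row_sortedP (f : {ffun 'I_m -> 'I_m.+1}) :
  reflect (forall i j : 'I_m, i < j -> A i = A j -> f i <= f j) (row_sorted f).
Proof.
apply: (iffP forallP) => [H i j ij Aij|H i].
  by have /forallP/(_ j) := H i; rewrite ij Aij eqxx.
by apply/forallP => j; apply/implyP => /andP[ij /eqP Aij]; apply: H.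
Qed.

(** At a first difference the smaller letter would be rarer in the other word's row, so the matrix
    determines the word. Conversely, swaps within rows keep the matrix and sort any word. *)
Lemma card_row_sorted : #|[set f in words | row_sorted f]| = #|matrix_of A @: words|.
Proof.
rewrite -(card_in_imset (f := matrix_of A)); last first.
  move=> f g; rewrite !inE => /andP[_ /row_sortedP Hf] /andP[_ /row_sortedP Hg] e.
  suff aux (f1 f2 : {ffun 'I_m -> 'I_m.+1}) (i : 'I_m) : matrix_of A f1 = matrix_of A f2 ->
      (forall i j : 'I_m, i < j -> A i = A j -> f2 i <= f2 j) ->
      (forall j : 'I_m, j < i -> f1 j = f2 j) -> f1 i < f2 i -> false.
    apply/ffunP; apply: first_difference => i IH; apply: val_inj.
    case: (ltngtP (f i) (g i)) => // lt; first by have := aux f g i e Hg IH lt.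
    by have := aux g f i (esym e) Hf (fun j h => esym (IH j h)) lt.
  move=> {}e H IH lt.
  suff /eqP e' : pred1 (f1 i) (f2 i) by move: lt; rewrite e' ltnn.
  apply: (matrix_of_row_strict (esym e)); last exact: eqxx.
  move=> j Aj /eqP fj; rewrite /=; case: (ltngtP j i) => [/IH ->|ij|/val_inj ->]; rewrite ?fj //.
  by have := H _ _ ij (esym Aj); rewrite fj; lia.
apply: eq_card => M; apply/imsetP/imsetP => [[f]|[g gW ->]].
  by rewrite inE => /andP[fW _] ->; exists f.
pose C (f : {ffun 'I_m -> 'I_m.+1}) := (f \in words) && (matrix_of A f == matrix_of A g).
have C0 : C g by rewrite /C gW eqxx.
case: (exists_swap_sorted (fun _ c => val c) C0) => f /andP[fW /eqP fg] Hf.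
exists f; rewrite ?fg // inE fW; apply/row_sortedP => i j ij Aij; apply: Hf => //.
by rewrite /C words_tperm // matrix_of_tperm // fg eqxx.
Qed.

(** * Rows sorted cyclically around a marked position *)

Section Toric.
Variable q : 'I_m.

(* The cyclic order of the letters starting at the letter [b] in position [q]; the
   other copies of [b] come first if they stand before [q] and last if after. *)
Definition toric_key (b : 'I_m.+1) (i : 'I_m) (c : 'I_m.+1) : nat :=
  if b < c then nat_of_ord c
  else if c < b then m.+2 + c
  else if i < q then 0 else if q < i then 3 * m + 5 else m.+1.

Definition toric_sorted (f : {ffun 'I_m -> 'I_m.+1}) :=
  [forall i : 'I_m, forall j : 'I_m, (i < j) && (A i == A j) ==>
     (toric_key (f q) i (f i) <= toric_key (f q) j (f j))].

Lemma toric_sortedP (f : {ffun 'I_m -> 'I_m.+1}) :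
  reflect (forall i j : 'I_m, i < j -> A i = A j ->
             toric_key (f q) i (f i) <= toric_key (f q) j (f j))
          (toric_sorted f).
Proof.
apply: (iffP forallP) => [H i j ij Aij|H i].
  by have /forallP/(_ j) := H i; rewrite ij Aij eqxx.
by apply/forallP => j; apply/implyP => /andP[ij /eqP Aij]; apply: H.
Qed.

Lemma toric_key_inj b i : injective (toric_key b i).
Proof.
move=> c c'; rewrite /toric_key => e; apply: val_inj => /=; move: e.
have := ltn_ord c; have := ltn_ord c'; have := ltn_ord b.
by do ?[case: ifP => ?]; lia.
Qed.

Lemma toric_key_crossing (b c c' : 'I_m.+1) (i j : 'I_m) : i <= q -> q <= j ->
  (i = q :> nat -> c = b :> nat) -> (i < q -> b <= c) ->
  (j = q :> nat -> c' = b :> nat) -> (q < j -> c' <= b) ->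
  toric_key b i c <= toric_key b j c'.
Proof.
rewrite /toric_key; have := ltn_ord c; have := ltn_ord c'; have := ltn_ord b.
by do ?[case: ifP => ?]; lia.
Qed.

(** The key at [q] is [m.+1]: letters larger than [f q] have smaller keys, and smaller letters have
    larger keys. *)
Lemma toric_sorted_row (f : {ffun 'I_m -> 'I_m.+1}) : toric_sorted f ->
  forall i : 'I_m, A i = A q -> (i < q -> f q <= f i) /\ (q < i -> f i <= f q).
Proof.
move=> /toric_sortedP H i Ai; have := ltn_ord (f i); have := ltn_ord (f q).
split=> lt; [have := H _ _ lt Ai|have := H _ _ lt (esym Ai)]; rewrite /toric_key !ltnn;
  by do ?[case: ifP => ?]; lia.
Qed.

(** If [f1 q < f2 q], letters at least [f2 q] are rarer in the row of [q] in [f1]: there they stand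
    only before [q], where all letters of [f2] are of that kind. *)
Lemma toric_sorted_letter (f g : {ffun 'I_m -> 'I_m.+1}) : toric_sorted f -> toric_sorted g ->
  matrix_of A f = matrix_of A g -> f q = g q.
Proof.
suff aux (f1 f2 : {ffun 'I_m -> 'I_m.+1}) : toric_sorted f1 -> toric_sorted f2 ->
    matrix_of A f1 = matrix_of A f2 -> f1 q < f2 q -> false.
  move=> Hf Hg e; apply: val_inj; case: (ltngtP (f q) (g q)) => // lt.
    by have := aux f g Hf Hg e lt.
  by have := aux g f Hg Hf (esym e) lt.
move=> /toric_sorted_row H1 /toric_sorted_row H2 e lt.
have := matrix_of_row_strict (i := q) (P := fun c => f2 q <= c) e.
rewrite leqnn => /(_ _ isT); rewrite leqNgt lt => H; apply: H => j Aj le.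
have [h1 h1'] := H1 j Aj; have [h2 h2'] := H2 j Aj.
by case: (ltngtP j q) => [/h2 //|/h1' ?|/val_inj -> //]; lia.
Qed.

(** At a first difference the letter of smaller key is again rarer in the other word, unless it
    recurs there later in the row. *)
Lemma toric_sorted_inj (f g : {ffun 'I_m -> 'I_m.+1}) : toric_sorted f -> toric_sorted g ->
  matrix_of A f = matrix_of A g -> f = g.
Proof.
move=> Hf Hg e; have eq := toric_sorted_letter Hf Hg e.
pose b := f q.
suff aux (f1 f2 : {ffun 'I_m -> 'I_m.+1}) (i : 'I_m) : f1 q = b -> f2 q = b ->
    toric_sorted f1 -> toric_sorted f2 -> matrix_of A f1 = matrix_of A f2 ->
    (forall j : 'I_m, j < i -> f1 j = f2 j) ->
    toric_key b i (f1 i) < toric_key b i (f2 i) -> false.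
  apply/ffunP; apply: first_difference => i IH; apply: (@toric_key_inj b i).
  case: (ltngtP (toric_key b i (f i)) (toric_key b i (g i))) => // lt.
    by have := aux f g i erefl (esym eq) Hf Hg e IH lt.
  by have := aux g f i (esym eq) erefl Hg Hf (esym e) (fun j h => esym (IH j h)) lt.
move=> {eq}e1 e2 H1 H2 {}e IH lt.
have neqi : i != q by apply: contraTneq lt => ->; rewrite e1 e2 ltnn.
have S1 := toric_sorted_row H1; have S2 := toric_sorted_row H2.
move: S1 S2 H1 H2; rewrite e1 e2 => S1 S2 /toric_sortedP + /toric_sortedP.
rewrite e1 e2 => H1 H2.
have [late|] := boolP [exists j : 'I_m, [&& A j == A i, i < j & f2 j == f1 i]]; last first.
  rewrite negb_exists => /forallP nolate.
  suff /eqP e' : pred1 (f1 i) (f2 i) by move: lt; rewrite e' ltnn.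
  apply: (matrix_of_row_strict (esym e)); last exact: eqxx.
  move=> j Aj /eqP fj; rewrite /=; case: (ltngtP j i) => [/IH ->|ij|/val_inj ->]; rewrite ?fj //.
  by have := nolate j; rewrite Aj ij fj !eqxx.
(* Only the letter [b] can change its key along a row, when the row crosses [q]. *)
case/existsP: late => j /and3P[/eqP Aj ij /eqP fj].
have := H2 _ _ ij (esym Aj); rewrite fj => le.
have [f1b iq qj] : [/\ f1 i = b, i < q & q <= j].
  move: lt le neqi; have := ltn_ord (f1 i); have := ltn_ord (f2 i).
  rewrite -(val_eqE i q) /toric_key /=; split; [apply: val_inj => /=| |]; move: lt le neqi;
  by do ?[case: ifP => ?]; lia.
have Aq : A i = A q.
  by symmetry; apply: (@block_between _ _ _ _ j) => //; apply: ltnW.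
(* In this row of [f1], letters above [b] stand only before [q]. From [i] up to [q] all letters of
   [f2] exceed [b], as a copy of [b] would have key 0, while [f1 i] is [b]. *)
have := matrix_of_row_strict (i := i) (P := fun c => b < c) e.
rewrite f1b ltnn => H; apply: H.
- move=> l; rewrite Aq => Al; have [h1 h1'] := S1 l Al; have [h2 h2'] := S2 l Al.
  case: (ltngtP l i) => [/IH ->//|il|/val_inj ->]; last by rewrite f1b ltnn.
  case: (ltngtP l q) => [lq|ql|/val_inj ->]; last by rewrite e1 ltnn.
  + move=> _; have := H2 _ _ il; rewrite Aq Al => /(_ erefl); move: lt (h2 lq).
    have := ltn_ord (f2 i); have := ltn_ord (f2 l).
    rewrite f1b /toric_key !ltnn iq lq /=.
    by do ?[case: ifP => ?]; lia.
  + by have := h1' ql; lia.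
- have [h2 h2'] := S2 i Aq; have := h2 iq; move: lt; rewrite f1b /toric_key !ltnn iq.
  by do ?[case: ifP => ?]; lia.
Qed.

Lemma card_toric_sorted : #|[set f in words | toric_sorted f]| = #|matrix_of A @: words|.
Proof.
rewrite -(card_in_imset (f := matrix_of A)); last first.
  move=> f g; rewrite !inE => /andP[_ Hf] /andP[_ Hg]; exact: toric_sorted_inj.
apply: eq_card => M; apply/imsetP/imsetP => [[f]|[g gW ->]].
  by rewrite inE => /andP[fW _] ->; exists f.
pose C (f : {ffun 'I_m -> 'I_m.+1}) := (f \in words) && (matrix_of A f == matrix_of A g).
have C0 : C g by rewrite /C gW eqxx.
have CT (f : {ffun 'I_m -> 'I_m.+1}) i j : C f -> A i = A j -> C [ffun l => f (tperm i j l)].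
  by move=> /andP[fW /eqP fg] Aij; rewrite /C words_tperm // matrix_of_tperm // fg eqxx.
(* Sorting the rows decreasingly reveals the letter that must stand in position [q]. *)
case: (exists_swap_sorted (fun _ (c : 'I_m.+1) => m - c) C0) => f0 Cf0 dec0.
pose b := f0 q.
pose C' (f : {ffun 'I_m -> 'I_m.+1}) := [&& C f, f q == b & [forall i : 'I_m, (A i == A q) ==>
  ((i < q) ==> (b <= f i)) && ((q < i) ==> (f i <= b))]].
have C'0 : C' f0.
  rewrite /C' Cf0 eqxx /=; apply/forallP => i; apply/implyP => /eqP Ai.
  have := ltn_ord (f0 i); have := ltn_ord (f0 q) => hb hi; rewrite /b.
  apply/andP; split; apply/implyP => lt.
    by have := dec0 _ _ lt (CT _ _ _ Cf0 Ai) erefl erefl; move: hb hi; rewrite /=; lia.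
  by have := dec0 _ _ lt (CT _ _ _ Cf0 (esym Ai)) erefl erefl; move: hb hi; rewrite /=; lia.
case: (exists_swap_sorted (toric_key b) C'0) => f /and3P[Cf /eqP fq /forallP rowq] Hf.
have {}rowq i : A i = A q -> (i < q -> b <= f i) /\ (q < i -> f i <= b).
  by move=> Ai; have := rowq i; rewrite Ai eqxx => /andP[/implyP ? /implyP ?].
have [fW /eqP fg] := andP Cf.
exists f; rewrite ?fg // inE fW; apply/toric_sortedP => i j ij Aij; rewrite fq.
(* Pairs meeting or crossing [q] are settled by the side condition in [C']. On one side of [q] the
   key does not depend on the position, so the swap argument applies. *)
have [/andP[iq qj]|same] := boolP ((i <= q) && (q <= j)).
  have Aq : A q = A i by exact: (@block_between _ _ _ _ j).
  apply: toric_key_crossing => //.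
  - by move=> /val_inj ->; rewrite fq.
  - by have [] := rowq i (esym Aq).
  - by move=> /val_inj ->; rewrite fq.
  - by have [] := rowq j (etrans (esym Aij) (esym Aq)).
have side (x y : 'I_m) : (val x == val q) = false -> (val y == val q) = false ->
    (x < q) = (y < q) -> forall c, toric_key b x c = toric_key b y c.
  move=> xq yq e c; rewrite /toric_key e.
  by have -> : (q < x) = (q < y) by move: xq yq e => /=; lia.
have [iq jq lq] : [/\ (val i == val q) = false, (val j == val q) = false
                    & (i < q) = (j < q)] by split; move: same ij => /=; lia.
apply: Hf => //; [|exact: side|by apply: side].
rewrite /C' CT // ffunE tpermD -?val_eqE ?iq ?jq // fq eqxx /=.
apply/forallP => l; apply/implyP => /eqP Al; rewrite ffunE.
case: tpermP => [li|lj|_ _].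
- have [h1 h2] := rowq j (etrans (esym Aij) (etrans (esym (congr1 A li)) Al)).
  rewrite li; apply/andP; split; apply/implyP => ?; [apply: h1|apply: h2]; lia.
- have [h1 h2] := rowq i (etrans Aij (etrans (esym (congr1 A lj)) Al)).
  rewrite lj; apply/andP; split; apply/implyP => ?; [apply: h1|apply: h2]; lia.
- by have [h1 h2] := rowq l Al; apply/andP; split; apply/implyP.
Qed.

End Toric.
End Words.

(** * Descent sets read off words *)

Section DescentsAsWords.
Variables (m : nat) (J S : {set 'I_m}).

Lemma block_ltE (s : {perm 'I_m}) (x y : 'I_m) : Des s \subset J ->
  block J x = block J y -> (x < y) = (s x < s y).
Proof.
move=> /(desf_subP _ (@val_perm_inj _ s)) inc e.
case: (ltngtP x y) => [xy|yx|/val_inj ->]; rewrite ?ltnn //.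
  exact/esym/inc.
by have := inc _ _ yx (esym e) => /= h; apply/esym/negbTE; rewrite -leqNgt ltnW.
Qed.

(** Distinct letters compare like the values of [s^-1]; a tie means a common block, where [s]
    increases, so that [i < j] gives an ascent. *)
Lemma Des_row_sorted (s : {perm 'I_m}) : Des s \subset J ->
  (Des s^-1%g \subset S) = row_sorted S (word_of J 1 s).
Proof.
move=> sJ; have cmp (i j : 'I_m) : i < j ->
    (s^-1%g i < s^-1%g j) = (word_of J 1 s i <= word_of J 1 s j).
  move=> ij; rewrite !ffunE !perm1.
  set x := (s^-1 i)%g; set y := (s^-1 j)%g.
  case: (ltngtP (block J x) (block J y)) => [/block_lt //|/block_lt yx|/val_inj e].
    by apply/negbTE; rewrite -leqNgt ltnW.
  by rewrite (block_ltE sJ e) !permKV.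
apply/(desf_subP _ (@val_perm_inj _ s^-1%g))/row_sortedP => H i j ij e.
  by rewrite -cmp //; apply: H.
by rewrite /= cmp //; apply: H.
Qed.

Variable k : 'I_m.

(* One-line notation (0-based) [k+1, ..., m-1, k, 0, ..., k-1]; the value [k] stands in
   position [rev_ord k]. *)
Definition toric_pos_nat (j : nat) : nat :=
  if j < rev_ord k then k + j.+1 else if j == rev_ord k then nat_of_ord k else j - (rev_ord k).+1.

Lemma toric_pos_nat_lt (j : 'I_m) : toric_pos_nat j < m.
Proof.
have := ltn_ord k; have := ltn_ord j; rewrite /toric_pos_nat /=.
by do ![case: ifP => ?]; lia.
Qed.

Definition toric_pos_fun (j : 'I_m) : 'I_m := Ordinal (toric_pos_nat_lt j).

Lemma toric_pos_inj : injective toric_pos_fun.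
Proof.
move=> i j /(congr1 val) /= e; apply: val_inj; move: e => /=.
have := ltn_ord k; have := ltn_ord i; have := ltn_ord j; rewrite /toric_pos_nat /=.
by do ![case: ifP => ?]; lia.
Qed.

Definition toric_pos : {perm 'I_m} := perm toric_pos_inj.

Lemma toric_posE (j : 'I_m) : toric_pos j = toric_pos_nat j :> nat.
Proof. by rewrite permE. Qed.

Lemma toric_pos_rev : toric_pos (rev_ord k) = k.
Proof. by apply: val_inj; rewrite /= toric_posE /toric_pos_nat ltnn eqxx. Qed.

(* The residue of [x - a - 1] modulo [m.+1], where [x = a] stands for
   the largest value [m] of the embedded permutation. *)
Definition toric_val (a x : nat) : nat :=
  if a < x then x - a.+1 else if x == a then m - a.+1 else x + m - a.

Lemma toric_val_inj (a : 'I_m) : {in gtn m &, injective (toric_val a)}.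
Proof.
move=> x y; rewrite !inE /toric_val => xm ym; have := ltn_ord a.
by do ![case: ifP => ?]; lia.
Qed.

(** The values of [rotate_values (lift ord_max k) s], read cyclically after the position of the
    largest one. *)
Definition toric_word (s : {perm 'I_m}) (j : 'I_m) : nat :=
  toric_val (s^-1%g k) (s^-1%g (toric_pos j)).

Lemma toric_word_inj s : injective (toric_word s).
Proof.
move=> i j /toric_val_inj e; apply: (@perm_inj _ toric_pos); apply: (@perm_inj _ s^-1%g).
by apply: val_inj; apply: e; rewrite inE ltn_ord.
Qed.

(* Relative to [q = rev_ord k], equal letters on opposite sides of [q] are decreasing in
   [toric_word s]: the hypothesis on [q] cannot be dropped. *)
Lemma toric_word_cmp (s : {perm 'I_m}) (i j : 'I_m) : Des s \subset J -> i < j ->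
  ~~ (i < rev_ord k < j) ->
  (toric_word s i < toric_word s j)
  = (toric_key (rev_ord k) (word_of J toric_pos s (rev_ord k)) i (word_of J toric_pos s i)
     <= toric_key (rev_ord k) (word_of J toric_pos s (rev_ord k)) j (word_of J toric_pos s j)).
Proof.
set q := rev_ord k => sJ ij side; rewrite !ffunE toric_pos_rev /toric_word.
have qE : q + k.+1 = m by have := ltn_ord k; rewrite /q /=; lia.
set a := (s^-1 k)%g.
(* Away from [q], letters show whether [x] lies below [a]: by block, and in a tie by the side of
   [q], because [toric_pos l < k] exactly when [q < l]. *)
have zone (l : 'I_m) : l != q :> nat -> let x := (s^-1 (toric_pos l))%g in
    x != a :> nat /\ (x < a) =
      (block J x < block J a) || ((block J x == block J a :> nat) && (q < l)).
  move=> lq x; split.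
    apply: contra lq => /eqP/val_inj/perm_inj e; rewrite (val_eqE l q).
    by rewrite -(inj_eq (@perm_inj _ toric_pos)) e toric_pos_rev.
  case: (ltngtP (block J x) (block J a)) => [/block_lt //|/block_lt h|/val_inj e] /=.
    by apply/negbTE; rewrite -leqNgt ltnW.
  rewrite (block_ltE sJ e) !permKV toric_posE /toric_pos_nat -/q.
  by have := ltn_ord l; case: (ltngtP l q) lq => //= *; lia.
have [iq|iq] := eqVneq (i : nat) q.
  have jq : j != q :> nat by move: ij; rewrite iq; lia.
  have [ya yzone] := zone j jq.
  have -> : toric_pos i = k by rewrite (val_inj iq : i = q) toric_pos_rev.
  rewrite -/a; set y := (s^-1 _)%g in ya yzone *.
  have lay := ltn_ord a; have ly := ltn_ord y; have lb := ltn_ord (block J y).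
  rewrite /toric_key /toric_val !ltnn iq !ltnn eqxx; move: (ij) yzone; rewrite iq => qj.
  by do ?[case: ifP => ?]; lia.
have [jq|jq] := eqVneq (j : nat) q.
  have [ya yzone] := zone i iq.
  have -> : toric_pos j = k by rewrite (val_inj jq : j = q) toric_pos_rev.
  rewrite -/a; set y := (s^-1 _)%g in ya yzone *.
  have lay := ltn_ord a; have ly := ltn_ord y; have lb := ltn_ord (block J y).
  have hi : i < q by rewrite -jq.
  rewrite /toric_key /toric_val !ltnn jq !ltnn eqxx hi; move: yzone.
  have -> : (q < i) = false by lia.
  by do ?[case: ifP => ?]; lia.
have [xa xz] := zone i iq; have [ya yz] := zone j jq.
have eside : (q < j) = (q < i) by move: side iq jq; lia.
have eside' : (j < q) = ~~ (q < i) by move: side iq jq; lia.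
have eside2 : (i < q) = ~~ (q < i) by move: iq; lia.
set x := (s^-1 _)%g in xa xz *; set y := (s^-1 _)%g in ya yz *.
have cxy : (x < y) = (block J x <= block J y).
  case: (ltngtP (block J x) (block J y)) => [/block_lt //|/block_lt h|/val_inj e].
    by apply/negbTE; rewrite -leqNgt ltnW.
  rewrite (block_ltE sJ e) !permKV !toric_posE /toric_pos_nat -/q eside' eside2.
  by case: ifP => ?; rewrite ?(negbTE iq) ?(negbTE jq); lia.
rewrite /toric_key /toric_val eside eside' eside2.
move: yz; rewrite eside => yz.
have lx := ltn_ord (block J x); have ly := ltn_ord (block J y).
have la := ltn_ord (block J a); have lx' := ltn_ord x; have ly' := ltn_ord y.
have la' := ltn_ord a.
rewrite (negbTE xa) (negbTE ya); move: xa ya xz yz cxy lx ly la lx' ly' la'.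
move: (nat_of_ord (block J x)) (nat_of_ord (block J y)) (nat_of_ord (block J a)).
move: (nat_of_ord x) (nat_of_ord y) (nat_of_ord a) (q < i) => u v w [] bu bv bw /=.
  by do ?[case: ifP => ?]; lia.
by do ?[case: ifP => ?]; lia.
Qed.

(** A row with positions on both sides of [q] contains [q], so both orders pass through [q] by
    transitivity; [toric_word_cmp] settles all other pairs. *)
Lemma toric_word_sorted (s : {perm 'I_m}) : Des s \subset J ->
  (desf (toric_word s) \subset S) = toric_sorted S (rev_ord k) (word_of J toric_pos s).
Proof.
set q := rev_ord k => sJ.
have across (i j : 'I_m) : i < q < j -> block S i = block S j ->
    block S i = block S q /\ block S q = block S j.
  move=> /andP[iq qj] e; have := block_between (ltnW iq) (ltnW qj) e.
  by rewrite -e => ->.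
apply/(desf_subP _ (@toric_word_inj s))/toric_sortedP => H i j ij e.
  have [cross|nocross] := boolP (i < q < j); last first.
    by rewrite -toric_word_cmp //; apply: H.
  have [e1 e2] := across _ _ cross e; have /andP[iq qj] := cross.
  apply: (@leq_trans (toric_key q (word_of J toric_pos s q) q (word_of J toric_pos s q))).
    by rewrite -toric_word_cmp ?ltnn ?andbF //; apply: H.
  by rewrite -toric_word_cmp ?ltnn //; apply: H.
have [cross|nocross] := boolP (i < q < j); last first.
  by rewrite toric_word_cmp //; apply: H.
have [e1 e2] := across _ _ cross e; have /andP[iq qj] := cross.
apply: (@ltn_trans (toric_word s q)).
  by rewrite toric_word_cmp ?ltnn ?andbF //; apply: H.
by rewrite toric_word_cmp ?ltnn //; apply: H.
Qed.

(** Both counts are the number of matrices realised by [words J]. *)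
Lemma card_toric_word_subset :
  #|[set s : {perm 'I_m} | Des s \subset J & desf (toric_word s) \subset S]|
  = #|[set s : {perm 'I_m} | Des s \subset J & Des s^-1%g \subset S]|.
Proof.
transitivity #|matrix_of (block S) @: words J|.
  rewrite -(card_toric_sorted J S (rev_ord k)) -(card_word_of _ toric_pos).
  by apply: eq_card => s; rewrite !inE; apply: andb_id2l => /toric_word_sorted.
rewrite -card_row_sorted -(card_word_of _ 1).
by apply: eq_card => s; rewrite !inE; apply: andb_id2l => /Des_row_sorted.
Qed.

End DescentsAsWords.

(** Inclusion-exclusion is applied twice, over [S] and over [J]. *)
Lemma card_toric_word (m : nat) (k : 'I_m) (J S : {set 'I_m}) :
  #|[set s : {perm 'I_m} | Des s == J & desf (toric_word k s) == S]|
  = #|[set s : {perm 'I_m} | Des s == J & Des s^-1%g == S]|.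
Proof.
move: S; apply: eq_card_fiber => S.
have swap (P Q : pred {perm 'I_m}) : #|[set s | P s & Q s]| = #|[set s | Q s & P s]|.
  by apply: eq_card => s; rewrite !inE andbC.
rewrite swap [RHS]swap; move: J; apply: eq_card_fiber => J.
by rewrite swap [RHS]swap card_toric_word_subset.
Qed.

(** * Cyclic shifts of positions and of values *)

Section CyclicShifts.
Variable m : nat.

Lemma cyc_expE (e : nat) (i : 'I_m.+1) : (cyc m.+1 ^+ e)%g i = (i + e) %% m.+1 :> nat.
Proof.
elim: e => [|e IHe]; first by rewrite expg0 perm1 addn0 modn_small.
by rewrite expgSr permM permE /= IHe -addn1 modnDml addn1 addnS.
Qed.

Lemma cyc_exp_mod (e f : nat) : e = f %[mod m.+1] -> (cyc m.+1 ^+ e = cyc m.+1 ^+ f)%g.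
Proof.
move=> ef; apply/permP => i; apply: val_inj.
by rewrite /= !cyc_expE -modnDmr ef modnDmr.
Qed.

(** The exponent is written [m - i] because this rotation carries [i] to [ord_max]. *)
Lemma mem_CnP (c : {perm 'I_m.+1}) :
  reflect (exists i : 'I_m.+1, c = (cyc m.+1 ^+ (m - i))%g) (c \in Cn m.+1).
Proof.
apply: (iffP (cycleP _ _)) => [[e ->]|[i ->]]; last by exists (m - i).
have le : e %% m.+1 <= m by rewrite -ltnS ltn_mod.
exists (inord (m - e %% m.+1)); apply: cyc_exp_mod.
by rewrite inordK ?ltnS ?leq_subr // subKn // modn_mod.
Qed.

Lemma embed_max (w : {perm 'I_m}) : embed w ord_max = ord_max.
Proof. exact: lift_perm_id. Qed.

Lemma embed_lift (w : {perm 'I_m}) (i : 'I_m) (x : 'I_m.+1) : x = i :> nat ->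
  embed w x = w i :> nat.
Proof.
move=> xi; have -> : x = lift ord_max i by apply: ord_inj; rewrite lift_max.
by rewrite lift_perm_lift lift_max.
Qed.

Lemma embed_inj : injective (@embed m).
Proof.
move=> w w' e; apply/permP => i; apply: val_inj.
by rewrite /= -!(@embed_lift _ i (lift ord_max i)) ?lift_max // e.
Qed.

Definition shift_pos (k : 'I_m.+1) (j : 'I_m) : 'I_m.+1 := (cyc m.+1 ^+ j.+1)%g k.

Lemma shift_posE k j : shift_pos k j = (k + j.+1) %% m.+1 :> nat.
Proof. exact: cyc_expE. Qed.

Lemma shift_pos_inj k : injective (shift_pos k).
Proof.
move=> i j /(congr1 val) /=; rewrite !shift_posE => /eqP; rewrite eqn_modDl.
by rewrite !modn_small ?ltnS // eqSS => /eqP/val_inj.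
Qed.

Lemma shift_pos_neq k j : shift_pos k j != k.
Proof.
rewrite -val_eqE /= shift_posE; have := ltn_ord j; have := ltn_ord k => lk lj.
case: (ltnP (k + j.+1) m.+1) => h; first by rewrite modn_small //; lia.
have -> : k + j.+1 = k + j.+1 - m.+1 + m.+1 by lia.
by rewrite modnDr modn_small; lia.
Qed.

Lemma shift_pos_onto k i : i != k -> exists j, i = shift_pos k j.
Proof.
move=> ik; have := ltn_ord i; have := ltn_ord k => lk li.
have ik' : (i : nat) <> k by move/eqP; rewrite (val_eqE i k); apply/negP.
have [ki|ki] := ltnP k i.
  have jm : i - k.+1 < m by lia.
  exists (Ordinal jm); apply: val_inj; rewrite /= shift_posE /=.
  by rewrite modn_small; lia.
have jm : i + m - k < m by lia.
exists (Ordinal jm); apply: val_inj; rewrite /= shift_posE /=.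
have -> : k + (i + m - k).+1 = i + m.+1 by lia.
by rewrite modnDr modn_small.
Qed.

Lemma ordS_shift_pos k (i j : 'I_m) : val j = i.+1 -> ordS (shift_pos k i) = shift_pos k j.
Proof.
move=> ji; apply: val_inj; rewrite /= !shift_posE.
change (nat_of_ord j) with (val j); rewrite ji.
by rewrite -addn1 modnDml addn1 -addnS.
Qed.

Lemma ordS_shift_pos_last k (i : 'I_m) : i.+1 = m -> ordS (shift_pos k i) = k.
Proof.
move=> im; apply: val_inj; rewrite /= shift_posE im -addn1 modnDml addn1 -addnS.
by rewrite modnDr modn_small.
Qed.

(** [k] is the position of the largest value and [D] the linear descent set of the word after it.
    The factor [0 < m] excludes the case where [k] is its own successor. *)
Definition cyclic_des (k : 'I_m.+1) (D : {set 'I_m}) : {set 'I_m.+1} :=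
  [set i | (i == k) && (0 < m) || [exists j in D, i == shift_pos k j]].

Lemma cDes_shift (p : {perm 'I_m.+1}) k : p k = ord_max ->
  cDes p = cyclic_des k (desf (fun j => val (p (shift_pos k j)))).
Proof.
move=> pk; have lt_max i : i != k -> p i < m.
  move=> ik; rewrite ltn_neqAle -ltnS ltn_ord andbT.
  apply: contra ik => /eqP pi; apply/eqP/(@perm_inj _ p); rewrite pk; exact: val_inj.
apply/setP => i; rewrite !inE; have [->|ik] /= := eqVneq i k.
  rewrite pk /=; case: (posnP m) => [m0|m_gt0] /=.
    have -> : ordS k = k.
      by apply: ord_inj; have := ltn_ord k; have := ltn_ord (ordS k); lia.
    rewrite pk /= ltnn; apply/esym/negbTE/existsPn => j; have := ltn_ord j; lia.
  apply: lt_max; rewrite -val_eqE /=; have := ltn_ord k => lk.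
  by case: (ltngtP k.+1 m.+1) => h; [rewrite modn_small|..|rewrite h modnn]; lia.
have [j ij] := shift_pos_onto ik; rewrite ij.
have -> : [exists j0 in desf (fun j => val (p (shift_pos k j))), shift_pos k j == shift_pos k j0]
   = (j \in desf (fun j => val (p (shift_pos k j)))).
  apply/existsP/idP => [[l /andP[lD /eqP/shift_pos_inj ->]] //|jD].
  by exists j; rewrite jD eqxx.
rewrite inE; have [jm|jm] := ltnP j.+1 m.
  rewrite (@ordS_shift_pos k j (Ordinal jm)) //.
  apply/idP/existsP => [h|[l /andP[/eqP lj h]]]; first by exists (Ordinal jm); rewrite eqxx.
  by have -> : Ordinal jm = l by apply: val_inj; rewrite /= -lj.
rewrite ordS_shift_pos_last; last by have := ltn_ord j; lia.
rewrite pk; transitivity false; first by apply/negbTE; rewrite -leqNgt -ltnS ltn_ord.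
apply/esym/negbTE/existsPn => l; have := ltn_ord l => /= lm.
by apply/negP => /andP[/eqP /= lj _]; lia.
Qed.

Definition rotate_positions (k : 'I_m.+1) (s : {perm 'I_m}) : {perm 'I_m.+1} :=
  pmul (embed s^-1%g) (cyc m.+1 ^+ (m - k))%g.

(** The exponent depends on [s]: it carries the value in position [k] to the largest one, so [k] has
    the same meaning as in [rotate_positions]. *)
Definition rotate_values (k : 'I_m.+1) (s : {perm 'I_m}) : {perm 'I_m.+1} :=
  pmul (cyc m.+1 ^+ (m - embed s^-1%g k))%g (embed s^-1%g).

Lemma rotate_positions_max k s : rotate_positions k s k = ord_max.
Proof.
rewrite permM; have -> : (cyc m.+1 ^+ (m - k))%g k = ord_max.
  by apply: val_inj; rewrite /= cyc_expE subnKC ?leq_ord // modn_small.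
exact: embed_max.
Qed.

Lemma rotate_values_max k s : rotate_values k s k = ord_max.
Proof.
by apply: val_inj; rewrite permM /= cyc_expE subnKC ?leq_ord // modn_small.
Qed.

Lemma eq_desf (u v : 'I_m -> nat) : u =1 v -> desf u = desf v.
Proof. by move=> e; apply/setP => i; rewrite !inE; apply: eq_existsb => j; rewrite !e. Qed.

Lemma desf_rotate_positions k s :
  desf (fun j => val (rotate_positions k s (shift_pos k j))) = Des s^-1%g.
Proof.
apply: eq_desf => j.
rewrite permM; apply: embed_lift; rewrite cyc_expE shift_posE modnDml.
have := ltn_ord k; have := ltn_ord j => lj lk.
have -> : k + j.+1 + (m - k) = j + m.+1 by lia.
by rewrite modnDr modn_small // ltnW.
Qed.

(** For [k = ord_max] the largest value is already in place and both rotations are trivial;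
    [toric_word] covers the other [k]. *)
Lemma desf_rotate_values_max s :
  desf (fun j => val (rotate_values ord_max s (shift_pos ord_max j))) = Des s^-1%g.
Proof.
rewrite -(desf_rotate_positions ord_max); congr desf.
by rewrite /rotate_values /rotate_positions /pmul embed_max subnn expg0 mulg1 mul1g.
Qed.

Lemma rotate_values_shift (k : 'I_m) s j :
  val (rotate_values (lift ord_max k) s (shift_pos (lift ord_max k) j)) = toric_word k s j.
Proof.
have lk := ltn_ord k; have lj := ltn_ord j.
rewrite permM /= cyc_expE (@embed_lift _ k (lift ord_max k)) ?lift_max // /toric_word.
set a := (s^-1 k)%g; have la := ltn_ord a.
have red (x y : nat) : x + m = y + a /\ y <= m \/ x + m = y + m.+1 + a /\ y <= m ->
    (x + (m - a)) %% m.+1 = y.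
  case=> -[e ley].
    have -> : x + (m - a) = y by lia.
    by rewrite modn_small.
  have -> : x + (m - a) = y + m.+1 by lia.
  by rewrite modnDr modn_small.
have shE := shift_posE (lift ord_max k) j; rewrite lift_max in shE.
(* At index [rev_ord k] the reading reaches position [ord_max], holding the value [m]; in
   [toric_word], [k] and [a] stand for them. *)
have [jq|jq] := eqVneq j (rev_ord k).
  have -> : shift_pos (lift ord_max k) j = ord_max.
    by apply: val_inj; rewrite /= shE jq /= modn_small; lia.
  rewrite embed_max /= jq toric_pos_rev -/a /toric_val ltnn eqxx; apply: red; lia.
have xk : toric_pos k j != k.
  by apply: contra jq => /eqP e; rewrite -(inj_eq (@perm_inj _ (toric_pos k))) e toric_pos_rev.
rewrite (@embed_lift _ (toric_pos k j)); last first.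
  rewrite shE toric_posE /toric_pos_nat; move: jq; rewrite -val_eqE /= => jq.
  rewrite (negbTE jq); case: ifP => h; first by rewrite modn_small; lia.
  have -> : k + j.+1 = j - (m - k.+1).+1 + m.+1 by lia.
  by rewrite modnDr modn_small; lia.
set x := (s^-1 _)%g; have lx := ltn_ord x.
have xa : x != a :> nat by rewrite val_eqE (inj_eq perm_inj).
rewrite /toric_val (negbTE xa); apply: red; case: ifP => ?; lia.
Qed.

End CyclicShifts.

(** * Parametrising both sums and comparing them *)

Section Sums.
Variables (m : nat) (J : {set 'I_m}).

(** [k] is recovered from [F k s] as the position of the largest value, so no permutation is counted
    twice. *)
Lemma sum_param (F : 'I_m.+1 -> {perm 'I_m} -> {perm 'I_m.+1}) :
  (forall k s, F k s k = ord_max) -> (forall k, injective (F k)) ->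
  (\sum_(p in [set F x.1 x.2 | x in setX [set: 'I_m.+1] [set s | Des s == J]]) weight p
   = \sum_k \sum_(s | Des s == J) weight (F k s))%R.
Proof.
move=> Fmax Finj; rewrite big_imset /=; last first.
  move=> [k s] [k' s'] _ _ /= e.
  have ek : k = k' by apply: (@perm_inj _ (F k' s')); rewrite -{1}e !Fmax.
  by rewrite ek in e *; rewrite (Finj _ _ _ e).
by rewrite pair_big_dep; apply: eq_bigl => -[k s]; rewrite !inE.
Qed.

Lemma rotate_positions_inj k : injective (@rotate_positions m k).
Proof. by move=> s s' /mulgI/embed_inj/invg_inj. Qed.

Lemma rotate_values_inj k : injective (@rotate_values m k).
Proof.
move=> s s' e; have /permP/(_ ord_max) := e.
rewrite !permM !embed_max => /(congr1 val) /=; rewrite !cyc_expE /= => /eqP.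
rewrite eqn_modDl !modn_small ?ltnS ?leq_subr // => /eqP e1.
by move: e; rewrite /rotate_values /pmul e1 => /mulIg/embed_inj/invg_inj.
Qed.

Lemma ACn_DinvJ : ACn (DinvJ J) =
  [set rotate_positions x.1 x.2 | x in setX [set: 'I_m.+1] [set s | Des s == J]].
Proof.
apply/setP => p; apply/imset2P/imsetP.
  case=> _ c /imsetP[s sJ ->] /mem_CnP[k ->] ->; exists (k, s) => //.
  by rewrite inE in_setT.
case=> -[k s] /setXP[_ sJ] ->; exists (embed s^-1%g) (cyc m.+1 ^+ (m - k))%g => //.
  exact: imset_f.
by apply/mem_CnP; exists k.
Qed.

Lemma CnA_DinvJ : CnA (DinvJ J) =
  [set rotate_values x.1 x.2 | x in setX [set: 'I_m.+1] [set s | Des s == J]].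
Proof.
apply/setP => p; apply/imset2P/imsetP.
  case=> c _ /mem_CnP[i ->] /imsetP[s sJ ->] ->.
  (* The rotation carries the value [i] to the largest one, so [k] must be the position of [i]. *)
  exists (((embed s^-1)^-1)%g i, s); first by rewrite inE in_setT.
  by rewrite /rotate_values /= permKV.
case=> -[k s] /setXP[_ sJ] ->.
exists (cyc m.+1 ^+ (m - embed s^-1%g k))%g (embed s^-1%g) => //.
  by apply/mem_CnP; exists (embed s^-1%g k).
exact: imset_f.
Qed.

Lemma weight_shift (p : {perm 'I_m.+1}) k : p k = ord_max ->
  weight p = ((\prod_(i in cyclic_des k (desf (fun j => val (p (shift_pos k j)))))
                 'X_(widen_ord (leqnSn m.+1) i)) * 'X_(ord_max) ^+ k.+1)%R.
Proof. by move=> pk; rewrite /weight (cDes_shift pk) -pk permK. Qed.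

End Sums.

Lemma sum_fiber (T I : finType) (V : zmodType) (P : pred T) (D : T -> {set I})
    (W : {set I} -> V) :
  (\sum_(x | P x) W (D x) = \sum_(S : {set I}) W S *+ #|[set x | P x & D x == S]|)%R.
Proof.
rewrite (partition_big D xpredT) //=; apply: eq_bigr => S _.
rewrite -sumr_const; apply: eq_big => [x|x /andP[_ /eqP ->] //].
by rewrite inE.
Qed.

(* The paper's n is m.+1 here (every positive integer n); J ⊆ [n-2] is a set of
   0-based positions i with i+1 < m, i.e. 1-based positions in [n-2]. *)
Theorem theorem4p1 (m : nat) (J : {set 'I_m})
  (hJ : J \subset [set i : 'I_m | i.+1 < m]) :
  (\sum_(p in CnA (DinvJ J)) weight p)%R = (\sum_(p in ACn (DinvJ J)) weight p)%R.
Proof.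
rewrite CnA_DinvJ ACn_DinvJ.
rewrite (sum_param _ (@rotate_values_max m) (@rotate_values_inj m)).
rewrite (sum_param _ (@rotate_positions_max m) (@rotate_positions_inj m)).
apply: eq_bigr => k _.
(* For fixed [k] the weight depends only on the linear descent set read after position [k]. *)
pose W S := ((\prod_(i in cyclic_des k S) 'X_(widen_ord (leqnSn m.+1) i))
             * 'X_(ord_max) ^+ k.+1 : {mpoly int[m.+2]})%R.
transitivity (\sum_(s | Des s == J) W (Des s^-1%g))%R; last first.
  apply: eq_bigr => s _.
  by rewrite (weight_shift (rotate_positions_max k s)) desf_rotate_positions.
transitivity (\sum_(s | Des s == J)
    W (desf (fun j => val (rotate_values k s (shift_pos k j)))))%R.
  by apply: eq_bigr => s _; rewrite (weight_shift (rotate_values_max k s)).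
rewrite !sum_fiber; apply: eq_bigr => S _; congr (_ *+ _)%R.
have [k' ->|->] := unliftP ord_max k; last first.
  by apply: eq_card => s; rewrite !inE desf_rotate_values_max.
rewrite -(card_toric_word k'); apply: eq_card => s; rewrite !inE.
by rewrite (eq_desf (rotate_values_shift k' s)).
Qed.
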